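(* Let $(X,r)$ be a braided set, $S=S(X,r)$ its associated monoid, and let $(S,r_S)$ be the graded $\mathbf{M3}$-monoid whose left and right actions are the unique ones extending the actions $r(x,y)=({}^xy,x^y)$ on $X$ to a graded $\mathbf{M3}$-monoid structure on $S$, with associated map $r_S(u,v)=({}^uv,u^v)$. Then: (1) $(S,r_S)$ is a graded braided monoid; (2) $(S,r_S)$ is non-degenerate if and only if $(X,r)$ is non-degenerate; (3) $(S,r_S)$ is involutive if and only if $(X,r)$ is involutive.
   Context: A braided set $(X,r)$ is a nonempty set $X$ with a bijective map $r:X\times X\to X\times X$, $r(x,y)=({}^xy,x^y)$, satisfying the Yang-Baxter equation (YBE) $r^{12}r^{23}r^{12}=r^{23}r^{12}r^{23}$ on $X^3$ ($r^{12}=r\times\mathrm{id}$, $r^{23}=\mathrm{id}\times r$). The associated monoid $S(X,r)$ is generated by $X$ with defining relations $xy=zt$ whenever $r(x,y)=(z,t)$; it is graded by length with degree-one part $X$. An $\mathbf{M3}$-monoid is a monoid $S$ with maps $(u,v)\mapsto{}^uv$ and $(u,v)\mapsto u^v$ from $S\times S$ to $S$ such that for all $a,b,u,v\in S$: ${}^a1=1$, ${}^1u=u$, $1^u=1$, $a^1=a$; ${}^{ab}u={}^a({}^bu)$, $a^{uv}=(a^u)^v$; ${}^a(uv)=({}^au)({}^{a^u}v)$, $(ab)^u=(a^{{}^bu})(b^u)$; and ($\mathbf{M3}$) ${}^uv\,u^v=uv$. Its associated map is $r_S(u,v)=({}^uv,u^v)$. It is graded if $S$ is graded by length, generated in degree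 one, and the actions preserve length. A braided monoid is an $\mathbf{M3}$-monoid $S$ for which $r_S$ is bijective and obeys the YBE on $S^3$. For a braided set $(X,r)$ it is a theorem that such a graded $\mathbf{M3}$-monoid structure on $S(X,r)$ extending the actions of $X$ exists and is unique. A map $r(x,y)=({}^xy,x^y)$ on a set (here $X$ or $S$) is non-degenerate if all maps $y\mapsto{}^xy$ and $y\mapsto y^x$ are bijections of the set; involutive if $r^2=\mathrm{id}$. *)

(* Defs.v *)
From HB Require Import structures.
From mathcomp Require Import all_boot.
From mathcomp Require Import boolp.

Set Implicit Arguments.
Unset Strict Implicit.
Unset Printing Implicit Defensive.

Local Open Scope group_scope.
Local Open Scope quotient_scope.

Section BraidedSets.
Variables (X : Type) (r : X * X -> X * X).

Definition r12 (p : X * X * X) : X * X * X :=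
  let: (x, y, z) := p in let: (a, b) := r (x, y) in (a, b, z).

Definition r23 (p : X * X * X) : X * X * X :=
  let: (x, y, z) := p in let: (a, b) := r (y, z) in (x, a, b).

Definition yang_baxter := r12 \o r23 \o r12 =1 r23 \o r12 \o r23.

(* r(x, y) = (^x y, x^y). *)
Definition lact_of (x y : X) : X := (r (x, y)).1.
Definition ract_of (x y : X) : X := (r (x, y)).2.

Record braided_set : Prop := BraidedSet {
  braided_set_nonempty : inhabited X;
  braided_set_bij : bijective r;
  braided_set_ybe : yang_baxter
}.

Definition nondegenerate :=
  (forall x, bijective (fun y => lact_of x y)) /\
  (forall x, bijective (fun y => ract_of y x)).

End BraidedSets.

Section M3Monoids.
Variables (S : monoidType) (lact ract : S -> S -> S).

(* lact u v is ^u v and ract u v is u^v. *)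
Record M3_monoid : Prop := M3Monoid {
  lact_g1 : forall a, lact a 1 = 1;
  lact_1g : forall u, lact 1 u = u;
  ract_1g : forall u, ract 1 u = 1;
  ract_g1 : forall a, ract a 1 = a;
  lact_Ml : forall a b u, lact (a * b) u = lact a (lact b u);
  ract_Mr : forall a u v, ract a (u * v) = ract (ract a u) v;
  lact_Mr : forall a u v, lact a (u * v) = lact a u * lact (ract a u) v;
  ract_Ml : forall a b u, ract (a * b) u = ract a (lact b u) * ract b u;
  M3_axiom : forall u v, lact u v * ract u v = u * v
}.

Definition assoc_map (p : S * S) : S * S := (lact p.1 p.2, ract p.1 p.2).

Record braided_monoid : Prop := BraidedMonoid {
  braided_monoid_M3 : M3_monoid;
  braided_monoid_bij : bijective assoc_map;
  braided_monoid_ybe : yang_baxter assoc_map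
}.

Variable deg : S -> nat.

Record graded_monoid : Prop := GradedMonoid {
  deg1 : deg 1 = 0%N;
  degM : forall u v, deg (u * v) = (deg u + deg v)%N;
  deg1_gen : forall u, exists2 s : seq S,
    all (fun v => deg v == 1%N) s & u = \big[*%g/1]_(v <- s) v
}.

Record graded_actions : Prop := GradedActions {
  deg_lact : forall u v, deg (lact u v) = deg v;
  deg_ract : forall u v, deg (ract u v) = deg u
}.

Definition graded_M3_monoid :=
  [/\ M3_monoid, graded_monoid & graded_actions].

Definition graded_braided_monoid :=
  [/\ braided_monoid, graded_monoid & graded_actions].

End M3Monoids.

Section AssociatedMonoid.
Variables (X : Type) (r : X * X -> X * X).

(* The congruence on the free monoid of words over X generated by
   xy ~ zt for r(x, y) = (z, t). *)
Inductive word_cong : seq X -> seq X -> Prop :=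
| word_cong_rel x y z t : r (x, y) = (z, t) ->
    word_cong [:: x; y] [:: z; t]
| word_cong_refl s : word_cong s s
| word_cong_sym s t : word_cong s t -> word_cong t s
| word_cong_trans s t u : word_cong s t -> word_cong t u -> word_cong s u
| word_cong_cat s s' t t' : word_cong s s' -> word_cong t t' ->
    word_cong (s ++ t) (s' ++ t').

(* {classic X} is X with the choice structure required by {eq_quot _}. *)
Definition word_congb (s t : seq {classic X}) : bool := `[< word_cong s t >].

Lemma word_congb_refl : reflexive word_congb.
Proof. by move=> s; apply/asboolP/word_cong_refl. Qed.

Lemma word_congb_sym : symmetric word_congb.
Proof.
by move=> s t; apply/idP/idP => /asboolP st; apply/asboolP/word_cong_sym.
Qed.

Lemma word_congb_trans : transitive word_congb.
Proof.
move=> t s u /asboolP st /asboolP tu; apply/asboolP.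
exact: word_cong_trans st tu.
Qed.

Canonical word_cong_equiv :=
  EquivRel word_congb word_congb_refl word_congb_sym word_congb_trans.

Definition assoc_monoid := {eq_quot word_cong_equiv}.
HB.instance Definition _ := Choice.on assoc_monoid.
HB.instance Definition _ := EqQuotient.on assoc_monoid.

Definition word (s : seq X) : assoc_monoid := \pi_assoc_monoid s.

Lemma wordP s t : word s = word t <-> word_cong s t.
Proof.
split=> [/eqP|st]; first by rewrite /word eqmodE => /asboolP.
by apply/eqP; rewrite /word eqmodE; apply/asboolP.
Qed.

Lemma word_repr (u : assoc_monoid) : word (repr u) = u.
Proof. exact: reprK. Qed.

Definition am_mul (u v : assoc_monoid) := word (repr u ++ repr v).
Definition am_one := word [::].

Lemma am_mulE s t : am_mul (word s) (word t) = word (s ++ t).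
Proof. by apply/wordP/word_cong_cat; apply/wordP; rewrite word_repr. Qed.

Lemma am_mulA : associative am_mul.
Proof.
move=> u v w; rewrite -[u]word_repr -[v]word_repr -[w]word_repr.
by rewrite !am_mulE catA.
Qed.

Lemma am_mul1g : left_id am_one am_mul.
Proof. by move=> u; rewrite -[u]word_repr am_mulE. Qed.

Lemma am_mulg1 : right_id am_one am_mul.
Proof. by move=> u; rewrite -[u]word_repr am_mulE cats0. Qed.

HB.instance Definition _ :=
  isMonoid.Build assoc_monoid am_mulA am_mul1g am_mulg1.

Lemma word_cat s t : word (s ++ t) = word s * word t.
Proof. by rewrite -am_mulE. Qed.

Lemma word_nil : word [::] = 1.
Proof. by []. Qed.

Definition gen (x : X) : assoc_monoid := word [:: x].

(* The defining relations are homogeneous, so this does not depend on the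
   chosen representative (len_word). *)
Definition len (u : assoc_monoid) : nat := size (repr u).

Lemma word_cong_size s t : word_cong s t -> size s = size t.
Proof.
by elim=> // [? ? ? _ -> _ -> | ? ? ? ? _ e _ e'] //; rewrite !size_cat e e'.
Qed.

Lemma len_word s : len (word s) = size s.
Proof. by apply/word_cong_size/wordP; rewrite word_repr. Qed.

Lemma gen_inj : injective gen.
Proof.
have size1 s t : word_cong s t -> size s = 1%N -> s = t.
  elim=> {s t} [//|//|s t st IH|s t u _ IHt _ IHu|s s' t t' sw IHs tw IHt].
  - by move=> t1; rewrite IH // (word_cong_size st).
  - by move=> s1; rewrite IHt // IHu // -IHt.
  - have := word_cong_size sw; have := word_cong_size tw.
    case: s s' t t' {sw tw} IHs IHt => [|x [|y s]] s' [|z t] t' //= IHs IHt.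
    + by case: s' {IHs} => // _ _; apply: IHt.
    + by case: t' {IHt} => // _ _ _; rewrite -IHs.
by move=> x y /wordP /size1 => /(_ erefl) [].
Qed.

Lemma assoc_monoid_graded : graded_monoid len.
Proof.
split=> [|u v|u]; first by rewrite -word_nil len_word.
  by rewrite -[u]word_repr -[v]word_repr -word_cat !len_word size_cat.
exists (map gen (repr u)).
  by elim: (repr u : seq X) => //= x s ->; rewrite len_word.
rewrite big_map -{1}[u]word_repr; elim: (repr u : seq X) => [|x s IHs].
  by rewrite big_nil.
by rewrite big_cons -IHs -word_cat.
Qed.

Definition extends_actions
    (lact ract : assoc_monoid -> assoc_monoid -> assoc_monoid) :=
  (forall x y, lact (gen x) (gen y) = gen (lact_of r x y)) /\
  (forall x y, ract (gen x) (gen y) = gen (ract_of r x y)).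

End AssociatedMonoid.

(* Main.v *)
(* Since S is generated by X, the Yang-Baxter equation and involutivity of r_S
   follow from those of r by closing each identity under products with the M3
   axioms.  Bijectivity of r_S and of the translations is harder: each of these
   maps has an evident inverse on words, which reads the letters one at a time
   while updating a state, and the Yang-Baxter equation says exactly that this
   inverse does not change when two adjacent letters are replaced by their image
   under r.  A step of such an inverse is an element of the monoid of maps
   A -> A * S (new state, output), so by the presentation of S the inverse
   descends to a morphism from S to that monoid. *)
Require Import Defs.
From mathcomp Require Import all_boot.
From mathcomp Require Import boolp.

Set Implicit Arguments.
Unset Strict Implicit.
Unset Printing Implicit Defensive.

Local Open Scope group_scope.

(** * Monoids of state transformers *)

Section StateTransformers.
Variables (A : Type) (S : monoidType).
Implicit Types f g h : A -> A * S.

Definition state_id : A -> A * S := fun a => (a, 1).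

(* The letters of a product are read from left to right in state_ltr and from
   right to left in state_rtl; the outputs keep the order of the product. *)
Definition state_ltr f g : A -> A * S := fun a =>
  let: (a1, u) := f a in let: (a2, v) := g a1 in (a2, u * v).

Definition state_rtl f g : A -> A * S := fun a =>
  let: (a1, v) := g a in let: (a2, u) := f a1 in (a2, u * v).

Lemma state_ltrA : associative state_ltr.
Proof.
move=> f g h; apply/funext => a; rewrite /state_ltr.
by case: (f a) => b u; case: (g b) => c v; case: (h c) => d w; rewrite mulgA.
Qed.

Lemma state_rtlA : associative state_rtl.
Proof.
move=> f g h; apply/funext => a; rewrite /state_rtl.
by case: (h a) => b u; case: (g b) => c v; case: (f c) => d w; rewrite mulgA.
Qed.

Lemma state_id_ltr : left_id state_id state_ltr.
Proof.
move=> f; apply/funext => a; rewrite /state_ltr /=.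
by case: (f a) => b u; rewrite mul1g.
Qed.

Lemma state_ltr_id : right_id state_id state_ltr.
Proof.
move=> f; apply/funext => a; rewrite /state_ltr /=.
by case: (f a) => b u; rewrite mulg1.
Qed.

Lemma state_id_rtl : left_id state_id state_rtl.
Proof.
move=> f; apply/funext => a; rewrite /state_rtl /=.
by case: (f a) => b u; rewrite mul1g.
Qed.

Lemma state_rtl_id : right_id state_id state_rtl.
Proof.
move=> f; apply/funext => a; rewrite /state_rtl /=.
by case: (f a) => b u; rewrite mulg1.
Qed.

End StateTransformers.

(** * The presentation of S by generators and relations *)

Section Presentation.
Variables (X : Type) (r : X * X -> X * X).
Local Notation S := (assoc_monoid r).
Local Notation gen := (gen r).

Lemma assoc_monoid_ind (P : S -> Prop) :
    P 1 -> (forall x, P (gen x)) -> (forall u v, P u -> P v -> P (u * v)) ->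
  forall u, P u.
Proof.
move=> P1 Px PM u; rewrite -[u]word_repr.
elim: (repr u : seq X) => [|x s IHs]; first by rewrite word_nil.
by rewrite -cat1s word_cat; apply: PM IHs; apply: Px.
Qed.

Lemma gen_rel x y z t : r (x, y) = (z, t) -> gen x * gen y = gen z * gen t.
Proof. by move=> rxy; rewrite -!word_cat; apply/wordP/word_cong_rel. Qed.

Lemma len1_gen (u : S) : len u = 1%N -> exists x, u = gen x.
Proof.
rewrite /len -{2}[u]word_repr.
by case: (repr u : seq X) => [|x []] // _; exists x.
Qed.

(** Universal property of the presentation: folding [op] along a word is constant on congruence
    classes. The target is a bare operation with its laws because [A -> A * S] carries two products,
    [state_ltr] and [state_rtl]. *)
Lemma assoc_monoid_lift (M : Type) (op : M -> M -> M) (idm : M)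
    (f : X -> M) :
    associative op -> left_id idm op -> right_id idm op ->
    (forall x y z t, r (x, y) = (z, t) -> op (f x) (f y) = op (f z) (f t)) ->
  exists T : S -> M,
    [/\ T 1 = idm, forall x, T (gen x) = f x
      & forall u v, T (u * v) = op (T u) (T v)].
Proof.
move=> opA op1m opm1 frel.
pose F s := foldr (fun x => op (f x)) idm s.
have Fcat s t : F (s ++ t) = op (F s) (F t).
  by elim: s => [|x s IHs] /=; rewrite ?op1m // IHs opA.
have Fcong s t : word_cong r s t -> F s = F t.
  elim=> {s t} [x y z t rxy|//|s t _ -> //|s t u _ -> _ -> //|].
    by rewrite /= !opm1; apply: frel.
  by move=> s s' t t' _ es _ et; rewrite !Fcat es et.
have Fword s : F (repr (word r s)) = F s.
  by apply/Fcong/wordP; rewrite word_repr.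
exists (fun u => F (repr u)); split=> [|x|u v].
- by rewrite -word_nil Fword.
- by rewrite Fword /= opm1.
- by rewrite -[in LHS](word_repr u) -[in LHS](word_repr v) -word_cat Fword Fcat.
Qed.

End Presentation.

(** * Graded M3-structures and their action on letters *)

Section GradedM3.
Variables (X : Type) (r : X * X -> X * X).
Local Notation S := (assoc_monoid r).
Local Notation gen := (gen r).
Variables (lact ract : S -> S -> S).
Hypothesis M3 : M3_monoid lact ract.
Hypothesis graded : graded_actions lact ract (@len X r).
Hypothesis extr : extends_actions lact ract.
Local Notation rS := (assoc_map lact ract).

(** Preservation of length keeps letters letters, so the inductions below can apply a hypothesis
    about letters to the result of an action. *)
Lemma lact_gen u x : exists y, lact u (gen x) = gen y.
Proof. by apply: len1_gen; rewrite (deg_lact graded) len_word. Qed.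

Lemma ract_gen x u : exists y, ract (gen x) u = gen y.
Proof. by apply: len1_gen; rewrite (deg_ract graded) len_word. Qed.

Lemma rS_gen x y z t : r (x, y) = (z, t) ->
  lact (gen x) (gen y) = gen z /\ ract (gen x) (gen y) = gen t.
Proof. by move=> rxy; rewrite extr.1 extr.2 /lact_of /ract_of rxy. Qed.

Lemma gen_rS x y z t :
  lact (gen x) (gen y) = gen z -> ract (gen x) (gen y) = gen t ->
  r (x, y) = (z, t).
Proof.
rewrite extr.1 extr.2 => zE tE.
by rewrite -(gen_inj zE) -(gen_inj tE) /lact_of /ract_of -surjective_pairing.
Qed.

(** [lact_lact] and [ract_ract] are the outer components of the Yang-Baxter equation for [rS]. By
    M3, each compares the actions of two factorizations of one product. *)
Lemma lact_lact a b u : lact (lact a b) (lact (ract a b) u) = lact a (lact b u).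
Proof. by rewrite -!(lact_Ml M3) (M3_axiom M3). Qed.

Lemma ract_ract a b u : ract (ract a (lact b u)) (ract b u) = ract (ract a b) u.
Proof. by rewrite -!(ract_Mr M3) (M3_axiom M3). Qed.

(** * The Yang-Baxter equation for [rS] *)

Hypothesis ybe : yang_baxter r.

(** The middle component, first at two letters. The equation for [r] is the case of a letter [u];
    for a product, moving [u1] past the letters leaves two letters, to which the hypothesis on [u2]
    applies. *)
Lemma lact_ract_gen x y u :
  ract (lact (gen x) (gen y)) (lact (ract (gen x) (gen y)) u) =
  lact (ract (gen x) (lact (gen y) u)) (ract (gen y) u).
Proof.
elim/assoc_monoid_ind: u x y => [x y|z x y|u1 u2 IH1 IH2 x y].
- by rewrite !(lact_g1 M3, ract_g1 M3).
- have := ybe (x, y, z); rewrite /r12 /r23 /=.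
  case rxy: (r (x, y)) => [a b]; case rbz: (r (b, z)) => [c d].
  case rac: (r (a, c)) => [e f]; case ryz: (r (y, z)) => [a' b'].
  case rxa: (r (x, a')) => [c' d']; case rdb: (r (d', b')) => [e' f'].
  move=> [_ fE _].
  rewrite (rS_gen rxy).1 (rS_gen rxy).2 (rS_gen rbz).1 (rS_gen rac).2.
  by rewrite (rS_gen ryz).1 (rS_gen ryz).2 (rS_gen rxa).2 (rS_gen rdb).1 fE.
- have [y2 y2E] := ract_gen y u1.
  have [x2 x2E] := ract_gen x (lact (gen y) u1).
  rewrite (lact_Mr M3) (ract_Mr M3) IH1 -(ract_ract (gen x)) x2E y2E IH2.
  by rewrite (lact_Mr M3) (ract_Mr M3) x2E y2E (ract_Mr M3) y2E.
Qed.

(** Induction on [a], then on [b] with the letter [x] free, since [x] is changed into another letter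
    by [b1]. *)
Lemma lact_ract a b u :
  ract (lact a b) (lact (ract a b) u) = lact (ract a (lact b u)) (ract b u).
Proof.
elim/assoc_monoid_ind: a b u => [b u|x b u|a1 a2 IH1 IH2 b u].
- by rewrite !(lact_1g M3, ract_1g M3).
- elim/assoc_monoid_ind: b x u => [x u|y x u|b1 b2 IH1 IH2 x u].
  + by rewrite !(lact_g1 M3, ract_g1 M3, ract_1g M3, lact_1g M3).
  + exact: lact_ract_gen.
  + have [x1 x1E] := ract_gen x b1.
    rewrite (ract_Mr M3) (lact_Mr M3) (ract_Ml M3).
    rewrite x1E IH2 -x1E lact_lact (lact_Ml M3) IH1.
    by rewrite (ract_Ml M3) (lact_Mr M3) ract_ract.
- rewrite (lact_Ml M3) (ract_Ml M3) (lact_Ml M3) IH1 IH2 lact_lact.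
  by rewrite (ract_Ml M3) (lact_Ml M3).
Qed.

Lemma rS_ybe : yang_baxter rS.
Proof.
move=> [[a b] u]; rewrite /r12 /r23 /=.
by rewrite lact_lact ract_ract lact_ract.
Qed.

(** The Yang-Baxter equation for [rS] at (u, b1, b2): moving [u] past two letters commutes with [r]
    on them. Hence an inverse computed letter by letter respects the defining relations. *)
Lemma gen_rel_lact u x y z t b1 b2 p q :
    lact u (gen b1) = gen x -> lact (ract u (gen b1)) (gen b2) = gen y ->
    r (x, y) = (z, t) -> r (b1, b2) = (p, q) ->
  [/\ lact u (gen p) = gen z, lact (ract u (gen p)) (gen q) = gen t
    & ract (ract u (gen p)) (gen q) = ract (ract u (gen b1)) (gen b2)].
Proof.
move=> xE yE /rS_gen[zE tE] /rS_gen[pE qE].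
by rewrite -pE -qE -lact_lact ract_ract -lact_ract xE yE.
Qed.

(** Mirror image, with [u] on the right of the two letters. *)
Lemma gen_rel_ract u x y z t b1 b2 p q :
    ract (gen b1) (lact (gen b2) u) = gen x -> ract (gen b2) u = gen y ->
    r (x, y) = (z, t) -> r (b1, b2) = (p, q) ->
  [/\ ract (gen p) (lact (gen q) u) = gen z, ract (gen q) u = gen t
    & lact (gen p) (lact (gen q) u) = lact (gen b1) (lact (gen b2) u)].
Proof.
move=> xE yE /rS_gen[zE tE] /rS_gen[pE qE].
by rewrite -pE -qE -ract_ract lact_lact lact_ract xE yE.
Qed.

(** * Bijectivity of [rS] *)

(* The inverse of r_S on S x X, curried as v |-> y |-> r_S^-1 (y, v) with the
   components of the result swapped: the state is the letter. *)
Lemma rS_inv_gen : bijective r ->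
  exists F : S -> X -> X * S,
    (forall u x y, lact u (gen x) = gen y -> F (ract u (gen x)) y = (x, u)) /\
    (forall v y x u, F v y = (x, u) ->
       lact u (gen x) = gen y /\ ract u (gen x) = v).
Proof.
case=> ri rK riK.
pose f y x := let: (y', x') := ri (x, y) in (x', gen y').
have [|F [F1 Fgen FM]] := assoc_monoid_lift (r := r) (f := f)
    (@state_ltrA X S) (@state_id_ltr X S) (@state_ltr_id X S).
  move=> x y z t rxy; apply/funext => s; rewrite /state_ltr /f.
  case ris: (ri (s, x)) => [y1 x1]; case ris1: (ri (x1, y)) => [y2 x2].
  (* This triple comes from undoing [r] at (s, x), then at (x1, y). One side of the equation leads
     back to (s, x, y) and on to (s, z, t); the other then shows that reading z, t from [s] outputs
     p, q and also ends in [x2]. *)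
  have := ybe (y1, y2, x2).
  rewrite /r12 /r23 /= -ris1 riK -ris riK rxy.
  case rpq: (r (y1, y2)) => [p q]; case rmn: (r (q, x2)) => [m n].
  case rkl: (r (p, m)) => [k l] [<- <- <-].
  by rewrite -rkl rK -rmn rK (gen_rel rpq).
exists F; split=> [u|].
  elim/assoc_monoid_ind: u => [x y|z x y|u1 u2 IH1 IH2 x y].
  - by rewrite (lact_1g M3) (ract_1g M3) F1 => e; rewrite (gen_inj e).
  - have [t tE] := ract_gen z (gen x).
    rewrite tE Fgen /f => yE.
    by rewrite -(gen_rS yE tE) rK.
  - have [w wE] := lact_gen u2 x.
    rewrite (lact_Ml M3) (ract_Ml M3) FM /state_ltr wE => yE.
    by rewrite (IH1 _ _ yE) (IH2 _ _ wE).
elim/assoc_monoid_ind => [y x u|z y x u|v1 v2 IH1 IH2 y x u].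
- by rewrite F1 => -[-> <-]; rewrite (lact_1g M3) (ract_1g M3).
- rewrite Fgen /f; case riyz: (ri (y, z)) => [y' z'] [<- <-].
  by apply: rS_gen; rewrite -riyz riK.
- rewrite FM /state_ltr.
  case F1E: (F v1 y) => [y1 u1]; case F2E: (F v2 y1) => [y2 u2] [<- <-].
  have [e1 <-] := IH1 _ _ _ F1E; have [e2 <-] := IH2 _ _ _ F2E.
  by rewrite (lact_Ml M3) (ract_Ml M3) e2 e1.
Qed.

(** The inverse sends (c, d) to [T c d]. The state d stands to the right of c, so it crosses the
    letters of c from right to left, each by [F]. *)
Lemma rS_bij : bijective r -> bijective rS.
Proof.
move=> /rS_inv_gen[F [FK KF]].
pose f x v := let: (b, u) := F v x in (u, gen b).
have [|T [T1 Tgen TM]] := assoc_monoid_lift (r := r) (f := f)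
    (@state_rtlA S S) (@state_id_rtl S S) (@state_rtl_id S S).
  move=> x y z t rxy; apply/funext => v; rewrite /state_rtl /f.
  case FvE: (F v y) => [b2 v1]; case Fv1E: (F v1 x) => [b1 v2].
  have [yE vE] := KF _ _ _ _ FvE; have [xE v1E] := KF _ _ _ _ Fv1E.
  move: yE vE; rewrite -v1E => yE vE.
  case rb: (r (b1, b2)) => [p q].
  (* Seen forwards, [v2] crosses b1, b2, producing x, y and ending as [v]; crossing p, q instead
     produces z, t and the same [v]. *)
  have [zE tE] := gen_rel_lact xE yE rxy rb.
  rewrite vE => {}vE.
  by rewrite -vE (FK _ _ _ tE) (FK _ _ _ zE) (gen_rel rb).
exists (fun p => T p.1 p.2) => [[u v]|[c d]]; rewrite /assoc_map /=.
  elim/assoc_monoid_ind: v u => [u|x u|v1 v2 IH1 IH2 u].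
  - by rewrite (lact_g1 M3) (ract_g1 M3) T1.
  - by have [y yE] := lact_gen u x; rewrite yE Tgen /f (FK _ _ _ yE).
  - by rewrite (lact_Mr M3) (ract_Mr M3) TM /state_rtl IH2 IH1.
elim/assoc_monoid_ind: c d => [d|x d|c1 c2 IH1 IH2 d].
- by rewrite T1 (lact_g1 M3) (ract_g1 M3).
- by rewrite Tgen /f; case FdE: (F d x) => [b u] /=;
  have [-> ->] := KF _ _ _ _ FdE.
- rewrite TM /state_rtl; move: (IH2 d); case: (T c2 d) => u2 v2 /= [<- <-].
  move: (IH1 u2); case: (T c1 u2) => u1 v1 /= [<- <-].
  by rewrite (lact_Mr M3) (ract_Mr M3).
Qed.

(** * Non-degeneracy *)

Lemma lact_gen_inv : (forall x, bijective (lact_of r x)) ->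
  forall u, exists g, forall x y, lact u (gen x) = gen y <-> g y = x.
Proof.
move=> nd; elim/assoc_monoid_ind => [|z|u1 u2 [g1 g1P] [g2 g2P]].
- by exists id => x y; rewrite (lact_1g M3); split=> [e|->] //; rewrite (gen_inj e).
- have [g gK Kg] := nd z; exists g => x y; rewrite extr.1.
  by split=> [e|<-]; rewrite ?Kg // -(gen_inj e) gK.
- exists (g2 \o g1) => x y; rewrite (lact_Ml M3) /=; split.
    by have [w wE] := lact_gen u2 x; rewrite wE => /g1P ->; apply/g2P.
  by move=> /g2P ->; apply/g1P.
Qed.

Lemma ract_gen_inv : (forall x, bijective (fun y => ract_of r y x)) ->
  forall u, exists g, forall x y, ract (gen x) u = gen y <-> g y = x.
Proof.
move=> nd; elim/assoc_monoid_ind => [|z|u1 u2 [g1 g1P] [g2 g2P]].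
- by exists id => x y; rewrite (ract_g1 M3); split=> [e|->] //; rewrite (gen_inj e).
- have [g gK Kg] := nd z; exists g => x y; rewrite extr.2.
  by split=> [e|<-]; rewrite ?Kg // -(gen_inj e) gK.
- exists (g1 \o g2) => x y; rewrite (ract_Mr M3) /=; split.
    by have [w wE] := ract_gen x u1; rewrite wE => /g2P ->; apply/g1P.
  by move=> /g1P ->; apply/g2P.
Qed.

(** The inverse of [lact u] reads a word from left to right, following [lact_Mr]: in state u, a
    letter y outputs the letter x with [lact u x] equal to y, and the state becomes [ract u x]. *)
Lemma lact_bij : (forall x, bijective (lact_of r x)) ->
  forall u, bijective (lact u).
Proof.
move=> /lact_gen_inv/choice[g gP].
have gK u x : lact u (gen (g u x)) = gen x by apply/gP.
pose f y u := (ract u (gen (g u y)), gen (g u y)).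
have [|T [T1 Tgen TM]] := assoc_monoid_lift (r := r) (f := f)
    (@state_ltrA S S) (@state_id_ltr S S) (@state_ltr_id S S).
  move=> x y z t rxy; apply/funext => u; rewrite /state_ltr /f.
  case rb: (r (g u x, g (ract u (gen (g u x))) y)) => [p q].
  have [/gP zE] := gen_rel_lact (gK _ _) (gK _ _) rxy rb.
  by rewrite zE => /gP -> ->; rewrite (gen_rel rb).
(* The final state is part of the claim because reading [v2] starts from the state left by [v1]. *)
have lactK u v : T (lact u v) u = (ract u v, v).
  elim/assoc_monoid_ind: v u => [u|x u|v1 v2 IH1 IH2 u].
  - by rewrite (lact_g1 M3) (ract_g1 M3) T1.
  - by have [y yE] := lact_gen u x; rewrite yE Tgen /f; move/gP: yE => ->.
  - by rewrite (lact_Mr M3) (ract_Mr M3) TM /state_ltr IH1 IH2.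
have Klact u v : lact u (T v u).2 = v /\ ract u (T v u).2 = (T v u).1.
  elim/assoc_monoid_ind: v u => [u|x u|v1 v2 IH1 IH2 u].
  - by rewrite T1 /= (lact_g1 M3) (ract_g1 M3).
  - by rewrite Tgen /= gK.
  - rewrite TM /state_ltr; move: (IH1 u); case: (T v1 u) => u1 w1 /= [e1 <-].
    move: (IH2 (ract u w1)); case: (T v2 _) => u2 w2 /= [e2 <-].
    by rewrite (lact_Mr M3) (ract_Mr M3) e1 e2.
move=> u; exists (fun v => (T v u).2) => v; first by rewrite lactK.
by have [] := Klact u v.
Qed.

(** Mirror image: [ract_Ml] acts on the right factor first, so the reading goes from right to left
    and the output x turns the state u into [lact x u]. *)
Lemma ract_bij : (forall x, bijective (fun y => ract_of r y x)) ->
  forall u, bijective (fun v => ract v u).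
Proof.
move=> /ract_gen_inv/choice[g gP].
have gK u x : ract (gen (g u x)) u = gen x by apply/gP.
pose f y u := (lact (gen (g u y)) u, gen (g u y)).
have [|T [T1 Tgen TM]] := assoc_monoid_lift (r := r) (f := f)
    (@state_rtlA S S) (@state_id_rtl S S) (@state_rtl_id S S).
  move=> x y z t rxy; apply/funext => u; rewrite /state_rtl /f.
  case rb: (r (g (lact (gen (g u y)) u) x, g u y)) => [p q].
  have [zE /gP tE] := gen_rel_ract (gK _ _) (gK _ _) rxy rb.
  by move/gP: zE; rewrite tE => -> ->; rewrite (gen_rel rb).
have ractK u v : T (ract v u) u = (lact v u, v).
  elim/assoc_monoid_ind: v u => [u|x u|v1 v2 IH1 IH2 u].
  - by rewrite (lact_1g M3) (ract_1g M3) T1.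
  - by have [y yE] := ract_gen x u; rewrite yE Tgen /f; move/gP: yE => ->.
  - by rewrite (lact_Ml M3) (ract_Ml M3) TM /state_rtl IH2 IH1.
have Kract u v : ract (T v u).2 u = v /\ lact (T v u).2 u = (T v u).1.
  elim/assoc_monoid_ind: v u => [u|x u|v1 v2 IH1 IH2 u].
  - by rewrite T1 /= (lact_1g M3) (ract_1g M3).
  - by rewrite Tgen /= gK.
  - rewrite TM /state_rtl; move: (IH2 u); case: (T v2 u) => u2 w2 /= [e2 <-].
    move: (IH1 (lact w2 u)); case: (T v1 _) => u1 w1 /= [e1 <-].
    by rewrite (lact_Ml M3) (ract_Ml M3) e1 e2.
move=> u; exists (fun v => (T v u).2) => v; first by rewrite ractK.
by have [] := Kract u v.
Qed.

(** The inverse of [h] preserves length too, so it sends letters to letters and restricts to an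
    inverse of [k]. *)
Lemma gen_restrict_bij (h : S -> S) (k : X -> X) :
    (forall u, len (h u) = len u) -> (forall x, h (gen x) = gen (k x)) ->
  bijective h -> bijective k.
Proof.
move=> hlen hk [h' hK Kh].
have /choice[k' k'E] y : exists x, h' (gen y) = gen x.
  by apply: len1_gen; rewrite -hlen Kh len_word.
exists k' => x; apply: (@gen_inj _ r); first by rewrite -k'E -hk hK.
by rewrite -hk -k'E Kh.
Qed.

Lemma rS_nondegenerate : nondegenerate rS <-> nondegenerate r.
Proof.
split=> [[ndl ndr]|[ndl ndr]]; split=> x.
- apply: gen_restrict_bij (ndl (gen x)) => [u|y].
    exact: deg_lact graded _ _.
  exact: extr.1.
- apply: gen_restrict_bij (ndr (gen x)) => [u|y].
    exact: deg_ract graded _ _.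
  exact: extr.2.
- exact: lact_bij.
- exact: ract_bij.
Qed.

(** * Involutivity *)

Lemma rS_involutive : involutive rS <-> involutive r.
Proof.
split=> [rSK [x y]|rK].
  case rxy: (r (x, y)) => [z t].
  have := rSK (gen x, gen y); rewrite /assoc_map /=.
  by rewrite (rS_gen rxy).1 (rS_gen rxy).2 => -[]; apply: gen_rS.
suff rSK u v : lact (lact u v) (ract u v) = u /\ ract (lact u v) (ract u v) = v.
  by move=> [u v]; rewrite /assoc_map /=; have [-> ->] := rSK u v.
elim/assoc_monoid_ind: u v => [v|x v|u1 u2 IH1 IH2 v].
- by rewrite (lact_1g M3) (ract_1g M3) (lact_g1 M3) (ract_g1 M3).
- elim/assoc_monoid_ind: v x => [x|y x|v1 v2 IH1 IH2 x].
  + by rewrite (lact_g1 M3) (ract_g1 M3) (lact_1g M3) (ract_1g M3).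
  + case rxy: (r (x, y)) => [z t].
    by rewrite (rS_gen rxy).1 (rS_gen rxy).2; apply: rS_gen; rewrite -rxy rK.
  (* Acted on by [v1], [x] becomes the letter [x1], so the inner hypothesis for [v2] applies to
     it. *)
  + have [x1 x1E] := ract_gen x v1.
    have := IH1 x; have := IH2 x1; rewrite -x1E.
    rewrite (lact_Mr M3) (ract_Mr M3) (lact_Ml M3) (ract_Ml M3).
    by move=> [-> ->] [-> ->].
- have [e2l e2r] := IH2 v; have [e1l e1r] := IH1 (lact u2 v).
  rewrite (lact_Ml M3) (ract_Ml M3) (lact_Mr M3) (ract_Mr M3).
  by rewrite e1l e1r e2l e2r.
Qed.

End GradedM3.

Theorem theorem3p14 (X : Type) (r : X * X -> X * X)
  (braided_r : braided_set r)
  (lact ract : assoc_monoid r -> assoc_monoid r -> assoc_monoid r)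
  (graded_M3_S : graded_M3_monoid lact ract (@len X r))
  (extends_r : extends_actions lact ract) :
  [/\ graded_braided_monoid lact ract (@len X r),
      nondegenerate (assoc_map lact ract) <-> nondegenerate r &
      involutive (assoc_map lact ract) <-> involutive r].
Proof.
case: graded_M3_S => M3 lenS graded; case: braided_r => _ bij_r ybe_r.
split; [|exact: rS_nondegenerate|exact: rS_involutive].
by split=> //; split; [|exact: rS_bij|exact: rS_ybe].
Qed.
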